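(* The category $\mathbf{XLb}$ of Leibniz crossed modules has enough projective objects.
   Context: Fix a field $\mathbb K$. A Leibniz algebra is a $\mathbb K$-vector space $\mathfrak q$ with a bilinear bracket satisfying $[x,[y,z]]=[[x,y],z]-[[x,z],y]$. A Leibniz action of $\mathfrak m$ on $\mathfrak n$ is a pair of bilinear maps $(m,n)\mapsto{}^{m}n$, $(n,m)\mapsto n^{m}$ with values in $\mathfrak n$ such that ${}^{[m,m']}n={}^{m}({}^{m'}n)+({}^{m}n)^{m'}$, ${}^{m}[n,n']=[{}^{m}n,n']-[{}^{m}n',n]$, $n^{[m,m']}=(n^{m})^{m'}-(n^{m'})^{m}$, $[n,n']^{m}=[n^{m},n']+[n,n'^{m}]$, ${}^{m}({}^{m'}n)=-{}^{m}(n^{m'})$, $[n,{}^{m}n']=-[n,n'^{m}]$. A Leibniz crossed module $(\mathfrak n,\mathfrak q,\delta)$ is a homomorphism $\delta:\mathfrak n\to\mathfrak q$ of Leibniz algebras with a Leibniz action of $\mathfrak q$ on $\mathfrak n$ such that $\delta({}^{q}n)=[q,\delta(n)]$, $\delta(n^{q})=[\delta(n),q]$, ${}^{\delta(n_1)}n_2=[n_1,n_2]=n_1^{\delta(n_2)}$. A homomorphism $(\varphi,\psi):(\mathfrak n,\mathfrak q,\delta)\to(\mathfrak n',\mathfrak q',\delta')$ is a pair of Leibniz homomorphisms with $\psi\delta=\delta'\varphi$, $\varphi({}^{q}n)={}^{\psi(q)}\varphi(n)$, $\varphi(n^{q})=\varphi(n)^{\psi(q)}$; it is surjective if both components are. The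 resulting category is $\mathbf{XLb}$. Projectivity is with respect to regular epimorphisms (equivalently, surjective homomorphisms); having enough projectives means that every object is the target of a regular epimorphism from a projective object. *)

(* Defs.v *)
From HB Require Import structures.
From mathcomp Require Import all_boot all_algebra.
From mathcomp Require Import boolp.

Set Implicit Arguments.
Unset Strict Implicit.
Unset Printing Implicit Defensive.

Import GRing.Theory.
Local Open Scope ring_scope.

(* [comp g f] is "g after f". *)
Record category := Category {
  obj :> Type;
  hom : obj -> obj -> Type;
  idm : forall A, hom A A;
  comp : forall A B C, hom B C -> hom A B -> hom A C;
  comp1m : forall A B (f : hom A B), comp (idm B) f = f;
  compm1 : forall A B (f : hom A B), comp f (idm A) = f;
  compA : forall A B C D (h : hom C D) (g : hom B C) (f : hom A B),
    comp h (comp g f) = comp (comp h g) f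
}.

Definition is_coequalizer (C : category) (X A B : C) (u v : hom X A)
    (f : hom A B) : Prop :=
  comp f u = comp f v /\
  forall (D : C) (g : hom A D), comp g u = comp g v ->
    exists! h : hom B D, comp h f = g.

Definition regular_epi (C : category) (A B : C) (f : hom A B) : Prop :=
  exists (X : C) (u v : hom X A), is_coequalizer u v f.

Definition projective (C : category) (P : C) : Prop :=
  forall (A B : C) (f : hom A B), regular_epi f ->
  forall g : hom P B, exists h : hom P A, comp f h = g.

Definition enough_projectives (C : category) : Prop :=
  forall A : C, exists (P : C) (p : hom P A), projective P /\ regular_epi p.

Record leibnizAlgebra (K : fieldType) := LeibnizAlgebra {
  leibniz_sort :> lmodType K;
  bracket : leibniz_sort -> leibniz_sort -> leibniz_sort;
  bracket_bilinear : bilinear_for *:%R *:%R bracket;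
  bracket_leibniz : forall x y z,
    bracket x (bracket y z) = bracket (bracket x y) z - bracket (bracket x z) y
}.

Notation "⟦ x , y ⟧" := (bracket x y)
  (at level 0, format "⟦ x ,  y ⟧") : ring_scope.

Record leibnizHom (K : fieldType) (m n : leibnizAlgebra K) := LeibnizHom {
  leibniz_fun :> m -> n;
  leibniz_linear : linear leibniz_fun;
  leibniz_bracket : forall x y, leibniz_fun ⟦x, y⟧ = ⟦leibniz_fun x, leibniz_fun y⟧
}.

(* [lact a x n] is the left action of x on n, written with x as a left
   superscript of n; [ract a n x] is the right action, with x as a right one. *)
Record leibnizAction (K : fieldType) (m n : leibnizAlgebra K) := LeibnizAction {
  lact : m -> n -> n;
  ract : n -> m -> n;
  lact_bilinear : bilinear_for *:%R *:%R lact;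
  ract_bilinear : bilinear_for *:%R *:%R ract;
  lact_bracketl : forall x y u,
    lact ⟦x, y⟧ u = lact x (lact y u) + ract (lact x u) y;
  lact_bracketr : forall x u v,
    lact x ⟦u, v⟧ = ⟦lact x u, v⟧ - ⟦lact x v, u⟧;
  ract_bracketr : forall u x y,
    ract u ⟦x, y⟧ = ract (ract u x) y - ract (ract u y) x;
  ract_bracketl : forall u v x,
    ract ⟦u, v⟧ x = ⟦ract u x, v⟧ + ⟦u, ract v x⟧;
  lact_lact : forall x y u, lact x (lact y u) = - lact x (ract u y);
  bracket_lact : forall u x v, ⟦u, lact x v⟧ = - ⟦u, ract v x⟧
}.

Record xlb (K : fieldType) := XLb {
  xlb_n : leibnizAlgebra K;
  xlb_q : leibnizAlgebra K;
  xlb_delta : leibnizHom xlb_n xlb_q;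
  xlb_act : leibnizAction xlb_q xlb_n;
  xlb_delta_lact : forall x u,
    xlb_delta (lact xlb_act x u) = ⟦x, xlb_delta u⟧;
  xlb_delta_ract : forall u x,
    xlb_delta (ract xlb_act u x) = ⟦xlb_delta u, x⟧;
  xlb_peifferl : forall u v, lact xlb_act (xlb_delta u) v = ⟦u, v⟧;
  xlb_peifferr : forall u v, ract xlb_act u (xlb_delta v) = ⟦u, v⟧
}.

Record xlbHom (K : fieldType) (X Y : xlb K) := XLbHom {
  xlb_phi : leibnizHom (xlb_n X) (xlb_n Y);
  xlb_psi : leibnizHom (xlb_q X) (xlb_q Y);
  xlb_hom_delta : forall u,
    xlb_psi (xlb_delta X u) = xlb_delta Y (xlb_phi u);
  xlb_hom_lact : forall x u,
    xlb_phi (lact (xlb_act X) x u) = lact (xlb_act Y) (xlb_psi x) (xlb_phi u);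
  xlb_hom_ract : forall u x,
    xlb_phi (ract (xlb_act X) u x) = ract (xlb_act Y) (xlb_phi u) (xlb_psi x)
}.

Lemma leibnizHom_ext (K : fieldType) (m n : leibnizAlgebra K)
  (f g : leibnizHom m n) : f =1 g -> f = g.
Proof.
case: f => f fl fb; case: g => g gl gb /= /funext fg.
by case: _ / fg gl gb => gl gb; congr LeibnizHom; apply: Prop_irrelevance.
Qed.

Lemma xlbHom_ext (K : fieldType) (X Y : xlb K) (f g : xlbHom X Y) :
  xlb_phi f =1 xlb_phi g -> xlb_psi f =1 xlb_psi g -> f = g.
Proof.
case: f => f1 f2 fd fl fr; case: g => g1 g2 gd gl gr /=.
move=> /leibnizHom_ext fg1 /leibnizHom_ext fg2.
case: _ / fg1 gd gl gr; case: _ / fg2 => gd gl gr.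
by congr XLbHom; apply: Prop_irrelevance.
Qed.

Lemma leibniz_id_linear (K : fieldType) (m : leibnizAlgebra K) :
  linear (fun x : m => x).
Proof. by []. Qed.

Definition leibniz_id (K : fieldType) (m : leibnizAlgebra K) : leibnizHom m m :=
  LeibnizHom (@leibniz_id_linear K m) (fun x y => erefl).

Lemma leibniz_comp_linear (K : fieldType) (m n p : leibnizAlgebra K)
  (g : leibnizHom n p) (f : leibnizHom m n) : linear (g \o f).
Proof. by move=> a x y; rewrite /= (leibniz_linear f) (leibniz_linear g). Qed.

Lemma leibniz_comp_bracket (K : fieldType) (m n p : leibnizAlgebra K)
  (g : leibnizHom n p) (f : leibnizHom m n) (x y : m) :
  (g \o f) ⟦x, y⟧ = ⟦(g \o f) x, (g \o f) y⟧.
Proof. by rewrite /= !leibniz_bracket. Qed.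

Definition leibniz_comp (K : fieldType) (m n p : leibnizAlgebra K)
    (g : leibnizHom n p) (f : leibnizHom m n) : leibnizHom m p :=
  LeibnizHom (leibniz_comp_linear g f) (leibniz_comp_bracket g f).

Definition xlb_id (K : fieldType) (X : xlb K) : xlbHom X X :=
  @XLbHom K X X (leibniz_id (xlb_n X)) (leibniz_id (xlb_q X))
    (fun _ => erefl) (fun _ _ => erefl) (fun _ _ => erefl).

Definition xlb_comp (K : fieldType) (X Y Z : xlb K)
  (g : xlbHom Y Z) (f : xlbHom X Y) : xlbHom X Z.
Proof.
apply: (@XLbHom K X Z (leibniz_comp (xlb_phi g) (xlb_phi f))
                      (leibniz_comp (xlb_psi g) (xlb_psi f))).
- by move=> u /=; rewrite !xlb_hom_delta.
- by move=> x u /=; rewrite !xlb_hom_lact.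
- by move=> u x /=; rewrite !xlb_hom_ract.
Defined.

Definition XLbCat (K : fieldType) : category.
Proof.
apply: (@Category (xlb K) (@xlbHom K) (@xlb_id K) (@xlb_comp K)).
- by move=> X Y f; apply: xlbHom_ext.
- by move=> X Y f; apply: xlbHom_ext.
- by move=> X Y Z T h g f; apply: xlbHom_ext.
Defined.

(* Main.v *)
Require Import Defs.
From HB Require Import structures.
From mathcomp Require Import all_boot all_algebra.
From mathcomp Require Import generic_quotient boolp.

Set Implicit Arguments.
Unset Strict Implicit.
Unset Printing Implicit Defensive.

Import GRing.Theory.
Local Open Scope ring_scope.
Local Open Scope quotient_scope.

(** Leibniz crossed modules are the models of a two-sorted equational theory,
    with one sort for the source [n] and one for the target [q]. So the usual
    argument for varieties applies: free objects are projective, because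
    regular epimorphisms are surjective, and every [A] is a quotient of the
    free crossed module on its own elements.

    Every construction of an object is the same one: terms over a two-sorted
    set of generators [G], two terms being identified when they take the same
    value under every valuation in a given class [Phi] of maps from [G] to
    crossed modules ([generated_xlb Phi]). The axioms hold in this quotient
    because they hold for the values. Two choices of [Phi] are used.

    - With all valuations it is the free crossed module ([free_extend]).
    - With a single valuation [e] in [B] it is, up to isomorphism, the
      substructure of [B] generated by the image of [e] ([span_embedding]).

    A surjective [f] is the coequalizer of the two projections from the free
    crossed module on the pairs identified by [f]: a map equalizes them exactly
    when it is constant on the fibres of [f] ([surjective_regular_epi]).

    Conversely, let [f : A -> B] be a coequalizer of [u] and [v]. It factors
    as [f = m f'] through its image, with [m] injective, so [f'] also
    coequalizes [u] and [v] and hence [f' = k f]. Then [m k f = f] forces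
    [m k = 1], and [m], with it [f], is surjective
    ([regular_epi_surjective]). *)

(** * Crossed modules as two-sorted algebras *)

Inductive sort := Sn | Sq.

Definition carrier (K : fieldType) (X : xlb K) (s : sort) : leibnizAlgebra K :=
  match s with Sn => xlb_n X | Sq => xlb_q X end.

Record is_morphism (K : fieldType) (X Y : xlb K)
    (h : forall s, carrier X s -> carrier Y s) : Prop := IsMorphism {
  morphism_linear : forall s, linear (h s);
  morphism_bracket : forall s x y, h s ⟦x, y⟧ = ⟦h s x, h s y⟧;
  morphism_delta : forall u, h Sq (xlb_delta X u) = xlb_delta Y (h Sn u);
  morphism_lact : forall x u,
    h Sn (lact (xlb_act X) x u) = lact (xlb_act Y) (h Sq x) (h Sn u);
  morphism_ract : forall u x,
    h Sn (ract (xlb_act X) u x) = ract (xlb_act Y) (h Sn u) (h Sq x)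
}.

Definition hom_fun (K : fieldType) (X Y : xlb K) (f : xlbHom X Y) s :
    carrier X s -> carrier Y s :=
  match s return carrier X s -> carrier Y s with
  | Sn => xlb_phi f
  | Sq => xlb_psi f
  end.

Arguments hom_fun {K X Y} f s _.

Lemma hom_fun_morphism (K : fieldType) (X Y : xlb K) (f : xlbHom X Y) :
  is_morphism (hom_fun f).
Proof.
split.
- by case=> a x y; apply: leibniz_linear.
- by case=> x y; apply: leibniz_bracket.
- exact: xlb_hom_delta.
- exact: xlb_hom_lact.
- exact: xlb_hom_ract.
Qed.

Lemma hom_fun_ext (K : fieldType) (X Y : xlb K) (f g : xlbHom X Y) :
  (forall s, hom_fun f s =1 hom_fun g s) -> f = g.
Proof. by move=> fg; apply: xlbHom_ext => x; [apply: (fg Sn)|apply: (fg Sq)]. Qed.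

Lemma hom_fun_comp (K : fieldType) (X Y Z : xlb K)
    (g : xlbHom Y Z) (f : xlbHom X Y) s x :
  hom_fun (xlb_comp g f) s x = hom_fun g s (hom_fun f s x).
Proof. by case: s x. Qed.

Lemma xlb_compA (K : fieldType) (X Y Z T : xlb K)
    (h : xlbHom Z T) (g : xlbHom Y Z) (f : xlbHom X Y) :
  xlb_comp h (xlb_comp g f) = xlb_comp (xlb_comp h g) f.
Proof. exact: (@Defs.compA (XLbCat K)). Qed.

Lemma morphism_hom (K : fieldType) (X Y : xlb K)
    (h : forall s, carrier X s -> carrier Y s) :
  is_morphism h -> exists f : xlbHom X Y, forall s, hom_fun f s =1 h s.
Proof.
move=> [hl hb hd hla hra].
exists (@XLbHom K X Y (LeibnizHom (hl Sn) (hb Sn)) (LeibnizHom (hl Sq) (hb Sq))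
          hd hla hra).
by case.
Qed.

Definition surjective_hom (K : fieldType) (X Y : xlb K) (f : xlbHom X Y) : Prop :=
  forall s (y : carrier Y s), exists x, hom_fun f s x = y.

(** The equations to check for [h] may be tested on images under [f], where
    they are those of [g]. *)
Lemma morphism_descends (K : fieldType) (X Y Z : xlb K)
    (f : xlbHom X Y) (g : xlbHom X Z) (h : forall s, carrier Y s -> carrier Z s) :
  surjective_hom f -> (forall s x, h s (hom_fun f s x) = hom_fun g s x) ->
  is_morphism h.
Proof.
move=> fS hf; have [fl fb fd fla fra] := hom_fun_morphism f.
have [gl gb gd gla gra] := hom_fun_morphism g.
split.
- move=> s a y1 y2; have [x1 <-] := fS s y1; have [x2 <-] := fS s y2.
  by rewrite -fl !hf gl.
- move=> s y1 y2; have [x1 <-] := fS s y1; have [x2 <-] := fS s y2.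
  by rewrite -fb !hf gb.
- by move=> u; have [x <-] := fS Sn u; rewrite -fd !hf gd.
- move=> y u; have [x <-] := fS Sq y; have [v <-] := fS Sn u.
  by rewrite -fla !hf gla.
- move=> u y; have [x <-] := fS Sq y; have [v <-] := fS Sn u.
  by rewrite -fra !hf gra.
Qed.

(** Dually, the equations for [h] may be tested after the injective [f]. *)
Lemma morphism_lifts (K : fieldType) (X Y Z : xlb K)
    (f : xlbHom Y Z) (g : xlbHom X Z) (h : forall s, carrier X s -> carrier Y s) :
  (forall s, injective (hom_fun f s)) ->
  (forall s x, hom_fun f s (h s x) = hom_fun g s x) -> is_morphism h.
Proof.
move=> fI fh; have [fl fb fd fla fra] := hom_fun_morphism f.
have [gl gb gd gla gra] := hom_fun_morphism g.
split.
- by move=> s a x y; apply: fI; rewrite fl !fh gl.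
- by move=> s x y; apply: fI; rewrite fb !fh gb.
- by move=> u; apply: (fI Sq); rewrite fd !fh gd.
- by move=> x u; apply: (fI Sn); rewrite fla !fh gla.
- by move=> u x; apply: (fI Sn); rewrite fra !fh gra.
Qed.

(** * Terms modulo a class of valuations *)

Inductive term (K : fieldType) (G : sort -> Type) : sort -> Type :=
| Gen s of G s : term K G s
| Zero s : term K G s
| Opp s of term K G s : term K G s
| Add s of term K G s & term K G s : term K G s
| Scale s of K & term K G s : term K G s
| Bracket s of term K G s & term K G s : term K G s
| Delta of term K G Sn : term K G Sq
| Lact of term K G Sq & term K G Sn : term K G Sn
| Ract of term K G Sn & term K G Sq : term K G Sn.

Arguments Zero {K G}.

HB.instance Definition _ K G s := gen_eqMixin (term K G s).
HB.instance Definition _ K G s := gen_choiceMixin (term K G s).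

Definition valuation (K : fieldType) (G : sort -> Type) (B : xlb K) : Type :=
  forall s, G s -> carrier B s.

Fixpoint eval (K : fieldType) (G : sort -> Type) (B : xlb K) (e : valuation G B)
    s (t : term K G s) : carrier B s :=
  match t in term _ _ s return carrier B s with
  | Gen s g => e s g
  | Zero s => 0
  | Opp s t => - eval e t
  | Add s t u => eval e t + eval e u
  | Scale s a t => a *: eval e t
  | Bracket s t u => ⟦eval e t, eval e u⟧
  | Delta t => xlb_delta B (eval e t)
  | Lact t u => lact (xlb_act B) (eval e t) (eval e u)
  | Ract t u => ract (xlb_act B) (eval e t) (eval e u)
  end.

(** Homomorphisms respect every operation of the signature. This gives both
    the uniqueness of homomorphisms out of a generated crossed module and the
    closure of images under terms. *)
Lemma eval_hom (K : fieldType) (G : sort -> Type) (X Y : xlb K)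
    (f : xlbHom X Y) (e : valuation G X) s (t : term K G s) :
  hom_fun f s (eval e t) = eval (fun s g => hom_fun f s (e s g)) t.
Proof.
have [fl fb _ _ _] := hom_fun_morphism f.
(* The case a = -1 of linearity at x = y = 0. *)
have f0 s' : hom_fun f s' 0 = 0.
  by have := fl s' (-1) 0 0; rewrite addr0 !scaleN1r oppr0 addNr.
elim: t => {s} /= [//|s|s t <-|s t <- u <-|s a t <-|s t <- u <-
  |t <-|t <- u <-|t <- u <-] //.
- by have := fl s (-1) (eval e t) 0; rewrite f0 !addr0 !scaleN1r.
- by have := fl s 1 (eval e t) (eval e u); rewrite !scale1r.
- by have := fl s a (eval e t) 0; rewrite f0 !addr0.
- exact: xlb_hom_delta.
- exact: xlb_hom_lact.
- exact: xlb_hom_ract.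
Qed.

Section Generated.

Variables (K : fieldType) (G : sort -> Type).
Variable Phi : forall B : xlb K, valuation G B -> Prop.

(** This relation is a congruence containing every instance of every identity
    valid in all crossed modules, whatever [Phi] is. It quantifies over all
    crossed modules but is a proposition, so the quotient stays in the
    universe of [G]. *)
Definition same_value s (t u : term K G s) : bool :=
  `[< forall B (e : valuation G B), Phi e -> eval e t = eval e u >].

Lemma same_value_refl s : reflexive (@same_value s).
Proof. by move=> t; apply/asboolP. Qed.

Lemma same_value_sym s : symmetric (@same_value s).
Proof. by move=> t u; apply/asboolP/asboolP => tu B e /tu. Qed.

Lemma same_value_trans s : transitive (@same_value s).
Proof.
move=> u t v /asboolP tu /asboolP uv; apply/asboolP => B e Be.
by rewrite tu ?uv.
Qed.

Canonical same_value_equiv s := EquivRel (@same_value s)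
  (@same_value_refl s) (@same_value_sym s) (@same_value_trans s).

Definition value_class s : Type := {eq_quot (same_value_equiv s)}.

HB.instance Definition _ s := Choice.on (value_class s).
HB.instance Definition _ s := EqQuotient.on (value_class s).

Definition cls s (t : term K G s) : value_class s := \pi_(value_class s) t.

(** Meant for [e] in [Phi], where [value_cls] makes it independent of the
    chosen representative. *)
Definition value (B : xlb K) (e : valuation G B) s (x : value_class s) :
  carrier B s := eval e (repr x).

Lemma value_cls (B : xlb K) (e : valuation G B) s (t : term K G s) :
  Phi e -> value e (cls t) = eval e t.
Proof.
move=> Be; have /eqmodP/asboolP : repr (cls t) = t %[mod (value_class s)].
  by rewrite reprK.
exact.
Qed.

(** The source of all the axioms below: an equation in the quotient reduces to
    the same equation between values in genuine crossed modules. *)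
Lemma value_sep s (x y : value_class s) :
  (forall B (e : valuation G B), Phi e -> value e x = value e y) -> x = y.
Proof.
move=> xy; rewrite -[x]reprK -[y]reprK; apply/eqmodP/asboolP => B e.
exact: xy.
Qed.

Definition cls_zero s : value_class s := cls (Zero s).
Definition cls_opp s (x : value_class s) := cls (Opp (repr x)).
Definition cls_add s (x y : value_class s) := cls (Add (repr x) (repr y)).
Definition cls_scale s (a : K) (x : value_class s) := cls (Scale a (repr x)).
Definition cls_bracket s (x y : value_class s) :=
  cls (Bracket (repr x) (repr y)).
Definition cls_delta (x : value_class Sn) := cls (Delta (repr x)).
Definition cls_lact (x : value_class Sq) (u : value_class Sn) :=
  cls (Lact (repr x) (repr u)).
Definition cls_ract (u : value_class Sn) (x : value_class Sq) :=
  cls (Ract (repr u) (repr x)).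

Section Operations.

Variables (B : xlb K) (e : valuation G B) (Be : Phi e).

Lemma value_zero s : value e (cls_zero s) = 0.
Proof. exact: value_cls. Qed.
Lemma value_opp s (x : value_class s) : value e (cls_opp x) = - value e x.
Proof. exact: value_cls. Qed.
Lemma value_add s (x y : value_class s) :
  value e (cls_add x y) = value e x + value e y.
Proof. exact: value_cls. Qed.
Lemma value_scale s a (x : value_class s) :
  value e (cls_scale a x) = a *: value e x.
Proof. exact: value_cls. Qed.
Lemma value_bracket s (x y : value_class s) :
  value e (cls_bracket x y) = ⟦value e x, value e y⟧.
Proof. exact: value_cls. Qed.
Lemma value_delta u : value e (cls_delta u) = xlb_delta B (value e u).
Proof. exact: value_cls. Qed.
Lemma value_lact x u :
  value e (cls_lact x u) = lact (xlb_act B) (value e x) (value e u).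
Proof. exact: value_cls. Qed.
Lemma value_ract u x :
  value e (cls_ract u x) = ract (xlb_act B) (value e u) (value e x).
Proof. exact: value_cls. Qed.

Definition value_linE := (value_zero, value_opp, value_add, value_scale).

End Operations.

Lemma cls_addA s : associative (@cls_add s).
Proof.
by move=> x y z; apply: value_sep => B e Be; rewrite !(value_linE Be) addrA.
Qed.

Lemma cls_addC s : commutative (@cls_add s).
Proof.
by move=> x y; apply: value_sep => B e Be; rewrite !(value_linE Be) addrC.
Qed.

Lemma cls_add0 s : left_id (cls_zero s) (@cls_add s).
Proof. by move=> x; apply: value_sep => B e Be; rewrite !(value_linE Be) add0r. Qed.

Lemma cls_addN s : left_inverse (cls_zero s) (@cls_opp s) (@cls_add s).
Proof. by move=> x; apply: value_sep => B e Be; rewrite !(value_linE Be) addNr. Qed.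

HB.instance Definition _ s := GRing.isZmodule.Build (value_class s)
  (@cls_addA s) (@cls_addC s) (@cls_add0 s) (@cls_addN s).

Lemma cls_scaleA s a b (x : value_class s) :
  cls_scale a (cls_scale b x) = cls_scale (a * b) x.
Proof. by apply: value_sep => B e Be; rewrite !(value_linE Be) scalerA. Qed.

Lemma cls_scale1 s : left_id 1 (@cls_scale s).
Proof. by move=> x; apply: value_sep => B e Be; rewrite !(value_linE Be) scale1r. Qed.

Lemma cls_scaleDr s : right_distributive (@cls_scale s) (@cls_add s).
Proof.
by move=> a x y; apply: value_sep => B e Be; rewrite !(value_linE Be) scalerDr.
Qed.

Lemma cls_scaleDl s (x : value_class s) a b :
  cls_scale (a + b) x = cls_add (cls_scale a x) (cls_scale b x).
Proof. by apply: value_sep => B e Be; rewrite !(value_linE Be) scalerDl. Qed.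

HB.instance Definition _ s := GRing.Zmodule_isLmodule.Build K (value_class s)
  (@cls_scaleA s) (@cls_scale1 s) (@cls_scaleDr s) (@cls_scaleDl s).

(** The additive rules once more, now phrased with the operations of the vector
    space structure, so that they can be used for rewriting. *)
Section Linear.

Variables (B : xlb K) (e : valuation G B) (Be : Phi e).

Lemma valueN s (x : value_class s) : value e (- x) = - value e x.
Proof. exact: value_opp. Qed.

Lemma valueD s (x y : value_class s) : value e (x + y) = value e x + value e y.
Proof. exact: value_add. Qed.

Lemma valueZ s a (x : value_class s) : value e (a *: x) = a *: value e x.
Proof. exact: value_scale. Qed.

Definition valueE := (valueN, valueD, valueZ, value_bracket Be, value_delta Be,
  value_lact Be, value_ract Be).

End Linear.

Lemma cls_bracket_bilinear s : bilinear_for *:%R *:%R (@cls_bracket s).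
Proof.
split=> [y a x x'|x a y y']; apply: value_sep => B e Be; rewrite !(valueE Be).
  exact: (bracket_bilinear _).1.
exact: (bracket_bilinear _).2.
Qed.

Lemma cls_bracket_leibniz s (x y z : value_class s) :
  cls_bracket x (cls_bracket y z) =
  cls_bracket (cls_bracket x y) z - cls_bracket (cls_bracket x z) y.
Proof.
by apply: value_sep => B e Be; rewrite !(valueE Be) bracket_leibniz.
Qed.

Definition cls_algebra s : leibnizAlgebra K :=
  LeibnizAlgebra (@cls_bracket_bilinear s) (@cls_bracket_leibniz s).

Definition cls_action : leibnizAction (cls_algebra Sq) (cls_algebra Sn).
Proof.
apply: (@LeibnizAction K (cls_algebra Sq) (cls_algebra Sn) cls_lact cls_ract).
- split=> [y a x x'|x a y y']; apply: value_sep => B e Be; rewrite !(valueE Be).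
    exact: (lact_bilinear _).1.
  exact: (lact_bilinear _).2.
- split=> [y a x x'|x a y y']; apply: value_sep => B e Be; rewrite !(valueE Be).
    exact: (ract_bilinear _).1.
  exact: (ract_bilinear _).2.
- by move=> x y u; apply: value_sep => B e Be; rewrite !(valueE Be) lact_bracketl.
- by move=> x u v; apply: value_sep => B e Be; rewrite !(valueE Be) lact_bracketr.
- by move=> u x y; apply: value_sep => B e Be; rewrite !(valueE Be) ract_bracketr.
- by move=> u v x; apply: value_sep => B e Be; rewrite !(valueE Be) ract_bracketl.
- by move=> x y u; apply: value_sep => B e Be; rewrite !(valueE Be) lact_lact.
- by move=> u x v; apply: value_sep => B e Be; rewrite !(valueE Be) bracket_lact.
Defined.

Definition cls_delta_hom : leibnizHom (cls_algebra Sn) (cls_algebra Sq).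
Proof.
apply: (@LeibnizHom K (cls_algebra Sn) (cls_algebra Sq) cls_delta).
- move=> a u v; apply: value_sep => B e Be; rewrite !(valueE Be).
  exact: leibniz_linear.
- by move=> u v; apply: value_sep => B e Be; rewrite !(valueE Be) leibniz_bracket.
Defined.

Definition generated_xlb : xlb K.
Proof.
apply: (@XLb K _ _ cls_delta_hom cls_action).
- by move=> x u; apply: value_sep => B e Be; rewrite !(valueE Be) xlb_delta_lact.
- by move=> u x; apply: value_sep => B e Be; rewrite !(valueE Be) xlb_delta_ract.
- by move=> u v; apply: value_sep => B e Be; rewrite !(valueE Be) xlb_peifferl.
- by move=> u v; apply: value_sep => B e Be; rewrite !(valueE Be) xlb_peifferr.
Defined.

Definition generator s (g : G s) : carrier generated_xlb s :=
  match s return G s -> carrier generated_xlb s with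
  | Sn => fun g => cls (Gen K g)
  | Sq => fun g => cls (Gen K g)
  end g.

Definition valuation_map (B : xlb K) (e : valuation G B) s :
    carrier generated_xlb s -> carrier B s :=
  match s return carrier generated_xlb s -> carrier B s with
  | Sn => @value B e Sn
  | Sq => @value B e Sq
  end.

Lemma valuation_map_generator (B : xlb K) (e : valuation G B) s (g : G s) :
  Phi e -> valuation_map e (generator g) = e s g.
Proof. by case: s g => g Be; apply: value_cls. Qed.

(** A valuation that was allowed to separate terms extends to a homomorphism. *)
Lemma valuation_map_hom (B : xlb K) (e : valuation G B) :
  Phi e -> exists f : xlbHom generated_xlb B,
    forall s, hom_fun f s =1 @valuation_map B e s.
Proof.
move=> Be; apply: morphism_hom; split.
- by case=> a x y /=; rewrite !(valueE Be).
- by case=> x y; apply: value_bracket.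
- exact: value_delta.
- exact: value_lact.
- exact: value_ract.
Qed.

Lemma valuation_map_sep s (x y : carrier generated_xlb s) :
  (forall B (e : valuation G B), Phi e ->
     valuation_map e x = valuation_map e y) -> x = y.
Proof. by case: s x y => x y; apply: value_sep. Qed.

(** The class of a term [t] is the value of [t] at the generators, because both
    have the same image under every valuation map, by [eval_hom]. *)
Lemma generated_by_generators s (x : carrier generated_xlb s) :
  exists t : term K G s, x = eval generator t.
Proof.
have [t xt] : exists t : term K G s, forall B (e : valuation G B),
    valuation_map e x = eval e t.
  by case: s x => x; exists (repr x).
exists t; apply: valuation_map_sep => B e Be.
have [f fE] := valuation_map_hom Be.
rewrite xt -fE eval_hom; congr (eval _ t).
apply: functional_extensionality_dep => s'; apply/funext => g.
by rewrite fE valuation_map_generator.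
Qed.

End Generated.

Lemma hom_generated_ext (K : fieldType) (G : sort -> Type)
    (Phi : forall B : xlb K, valuation G B -> Prop) (Y : xlb K)
    (f g : xlbHom (generated_xlb Phi) Y) :
  (forall s (a : G s),
     hom_fun f s (generator Phi a) = hom_fun g s (generator Phi a)) ->
  f = g.
Proof.
move=> fg; apply: hom_fun_ext => s x.
have [t ->] := generated_by_generators x; rewrite !eval_hom.
congr (eval _ t); apply: functional_extensionality_dep => s'.
exact/funext/fg.
Qed.

(** * Free crossed modules and spans *)

Definition free_xlb (K : fieldType) (G : sort -> Type) : xlb K :=
  generated_xlb (fun (B : xlb K) (_ : valuation G B) => True).

Definition free_generator (K : fieldType) (G : sort -> Type) s (g : G s) :
  carrier (free_xlb K G) s := generator _ g.

Lemma free_extend (K : fieldType) (G : sort -> Type) (B : xlb K)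
    (e : valuation G B) :
  exists f : xlbHom (free_xlb K G) B,
    forall s (g : G s), hom_fun f s (free_generator K g) = e s g.
Proof.
have [f fE] := @valuation_map_hom K G (fun _ _ => True) B e I.
by exists f => s g; rewrite fE; apply: valuation_map_generator.
Qed.

(** An indexed family rather than an equation, since the codomain [B'] of the
    valuation varies too. *)
Inductive only (K : fieldType) (G : sort -> Type) (B : xlb K)
    (e : valuation G B) : forall B' : xlb K, valuation G B' -> Prop :=
  Only : only e e.

(** Terms are identified exactly when their values under [e] agree, so the
    evaluation at [e] is injective: its source is the substructure of [B]
    generated by the image of [e]. *)
Lemma span_embedding (K : fieldType) (G : sort -> Type) (B : xlb K)
    (e : valuation G B) :
  exists m : xlbHom (generated_xlb (only e)) B,
    (forall s, injective (hom_fun m s)) /\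
    forall s (g : G s), hom_fun m s (generator (only e) g) = e s g.
Proof.
have [m mE] := valuation_map_hom (Only e).
exists m; split=> [s x y|s g]; rewrite !mE; last exact/valuation_map_generator/Only.
by move=> xy; apply: valuation_map_sep => B' e'; case.
Qed.

(** * Regular epimorphisms are the surjective homomorphisms *)

(** A map equalizing the two projections is constant on the fibres of [f], so
    it factors through [f] as a map of sets; the factor is a homomorphism by
    [morphism_descends]. *)
Lemma surjective_regular_epi (K : fieldType) (A B : XLbCat K) (f : Defs.hom A B) :
  surjective_hom f -> regular_epi f.
Proof.
move=> fS.
pose G s := {p : carrier A s * carrier A s | hom_fun f s p.1 = hom_fun f s p.2}.
have [u uE] := @free_extend K G A (fun s g => (sval g).1).
have [v vE] := @free_extend K G A (fun s g => (sval g).2).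
exists (free_xlb K G), u, v; split=> [|D g guv].
  apply: hom_generated_ext => s a; rewrite !hom_fun_comp.
  by rewrite [hom_fun u s _]uE [hom_fun v s _]vE; case: a.
have g_ker s x y : hom_fun f s x = hom_fun f s y ->
    hom_fun g s x = hom_fun g s y.
  move=> xy; pose a : G s := exist _ (x, y) xy.
  by rewrite -[x](uE s a) -[y](vE s a) -!hom_fun_comp [xlb_comp _ _]guv.
(* A set-theoretic section of f. *)
pose r s y := sval (cid (fS s y)).
have rK s y : hom_fun f s (r s y) = y by rewrite /r; case: cid.
have hE s x : hom_fun g s (r s (hom_fun f s x)) = hom_fun g s x.
  exact/g_ker/rK.
have /morphism_hom[h hg] :=
  morphism_descends (h := fun s y => hom_fun g s (r s y)) fS hE.
exists h; split=> [|h' h'g]; apply: hom_fun_ext => s x.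
  by rewrite hom_fun_comp hg.
by rewrite hg -(h'g : xlb_comp h' f = g) hom_fun_comp rK.
Qed.

(** Uniqueness in the universal property is used for [B] itself: both [m k]
    and the identity factor [f] through [f]. *)
Lemma regular_epi_surjective (K : fieldType) (A B : XLbCat K) (f : Defs.hom A B) :
  regular_epi f -> surjective_hom f.
Proof.
move=> [X [u [v [fuv f_univ]]]].
have [m [mI mE]] := span_embedding (hom_fun f).
have /morphism_hom[f' f'E] := morphism_lifts mI mE.
have mf' : xlb_comp m f' = f.
  by apply: hom_fun_ext => s x; rewrite hom_fun_comp f'E mE.
have mf'_uv : xlb_comp (xlb_comp m f') u = xlb_comp (xlb_comp m f') v.
  by rewrite mf'; apply: fuv.
have f'uv : xlb_comp f' u = xlb_comp f' v.
  apply: hom_fun_ext => s x; apply: mI.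
  by rewrite -!hom_fun_comp !xlb_compA mf'_uv.
have [k [kf' _]] := f_univ _ _ f'uv.
have [h [_ h_uniq]] := f_univ _ f fuv.
have mk : xlb_comp m k = xlb_id B.
  rewrite -(h_uniq (xlb_id B)); last exact: (@comp1m (XLbCat K)).
  rewrite -(h_uniq (xlb_comp m k)) //.
  rewrite /= -xlb_compA -[RHS]mf'; congr (xlb_comp m _); exact: kf'.
(* [y = m (k y)] is the value at f of a term t over A, hence the image under f
   of the value of t computed in A. *)
move=> s y; have [t kyt] := generated_by_generators (hom_fun k s y).
exists (eval (fun _ x => x) t); rewrite eval_hom.
have -> : y = hom_fun m s (hom_fun k s y).
  by rewrite -hom_fun_comp mk; case: s y {kyt t}.
rewrite kyt eval_hom; congr (eval _ t).
by apply: functional_extensionality_dep => s'; apply/funext => x; rewrite mE.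
Qed.

(** * Projectivity *)

(** A homomorphism out of a free crossed module is lifted by choosing a
    preimage for the image of each generator. *)
Lemma free_projective (K : fieldType) (G : sort -> Type) :
  projective (C := XLbCat K) (free_xlb K G).
Proof.
move=> A B f /regular_epi_surjective fS g.
pose e s (a : G s) := sval (cid (fS s (hom_fun g s (free_generator K a)))).
have [h hE] := free_extend e.
exists h; apply: hom_generated_ext => s a.
rewrite hom_fun_comp [hom_fun h s _]hE /e; by case: cid.
Qed.

Theorem theorem2p5 (K : fieldType) : enough_projectives (XLbCat K).
Proof.
move=> A; have [p pE] := @free_extend K (carrier A) A (fun _ x => x).
exists (free_xlb K (carrier A)), p; split; first exact: free_projective.
by apply: surjective_regular_epi => s x; exists (free_generator K x).
Qed.
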